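(* Let $F_A$, $G_B$ and $H_C$ be three interval-valued hesitant fuzzy soft sets over $(U,E)$, with nonempty parameter sets $A,B,C\subseteq E$. Then: (i) $F_A\tilde{\cup}G_B=G_B\tilde{\cup}F_A$; (ii) $F_A\tilde{\cap}G_B=G_B\tilde{\cap}F_A$ (provided $A\cap B\neq\emptyset$); (iii) $F_A\tilde{\cup}(G_B\tilde{\cup}H_C)=(F_A\tilde{\cup}G_B)\tilde{\cup}H_C$; (iv) $F_A\tilde{\cap}(G_B\tilde{\cap}H_C)=(F_A\tilde{\cap}G_B)\tilde{\cap}H_C$ (provided $A\cap B\cap C\neq\emptyset$).
   Context: $U$ is an initial universe and $E$ a set of parameters. An interval-valued hesitant fuzzy element (IVHFE) is a nonempty set of closed intervals $\gamma=[\gamma^L,\gamma^U]\subseteq[0,1]$. For IVHFEs $\mu_1,\mu_2$: $\mu_1\cup\mu_2=\{[\max(\gamma_1^L,\gamma_2^L),\max(\gamma_1^U,\gamma_2^U)]:\gamma_1\in\mu_1,\gamma_2\in\mu_2\}$ and $\mu_1\cap\mu_2=\{[\min(\gamma_1^L,\gamma_2^L),\min(\gamma_1^U,\gamma_2^U)]:\gamma_1\in\mu_1,\gamma_2\in\mu_2\}$. An interval-valued hesitant fuzzy soft set $F_A$ over $(U,E)$, with $A\subseteq E$, assigns to each $e\in A$ and each $h\in U$ an IVHFE $\mu_{F(e)}(h)$. Two such sets are equal when they have the same parameter set and the same IVHFE for every $e$ and $h$. The union $F_A\tilde\cup G_B$ has parameter set $A\cup B$ and its value at $(e,h)$ is $\mu_{F(e)}(h)$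 if $e\in A\setminus B$, $\mu_{G(e)}(h)$ if $e\in B\setminus A$, and $\mu_{F(e)}(h)\cup\mu_{G(e)}(h)$ if $e\in A\cap B$. The intersection $F_A\tilde\cap G_B$, defined when $A\cap B\neq\emptyset$, has parameter set $A\cap B$ and values $\mu_{F(e)}(h)\cap\mu_{G(e)}(h)$. *)

(* Defs.v *)
From HB Require Import structures.
From mathcomp Require Import all_boot all_order all_algebra.
From mathcomp Require Import boolp classical_sets reals.

Set Implicit Arguments.
Unset Strict Implicit.
Unset Printing Implicit Defensive.

Import Order.TTheory GRing.Theory Num.Theory.
Local Open Scope ring_scope.
Local Open Scope classical_set_scope.

(* A closed interval [lo, hi] contained in [0, 1], given by its endpoints. *)
Record unit_ivl (R : realType) := UnitIvl {
  lo : R;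
  hi : R;
  lo_ge0 : 0 <= lo;
  lo_le_hi : lo <= hi;
  hi_le1 : hi <= 1 }.

Lemma unit_ivl_ext (R : realType) (x y : unit_ivl R) :
  lo x = lo y -> hi x = hi y -> x = y.
Proof.
case: x y => [l u p q r] [l' u' p' q' r'] /= el eu; subst l' u'.
by rewrite (bool_irrelevance p p') (bool_irrelevance q q')
           (bool_irrelevance r r').
Qed.

Section IntervalMaxMin.
Variables (R : realType) (x y : unit_ivl R).

Fact ivl_max_lo_ge0 : 0 <= Num.max (lo x) (lo y).
Proof. by rewrite le_max lo_ge0. Qed.

Fact ivl_max_lo_le_hi : Num.max (lo x) (lo y) <= Num.max (hi x) (hi y).
Proof. by rewrite ge_max !le_max !lo_le_hi orbT. Qed.

Fact ivl_max_hi_le1 : Num.max (hi x) (hi y) <= 1.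
Proof. by rewrite ge_max !hi_le1. Qed.

Definition ivl_max : unit_ivl R :=
  UnitIvl ivl_max_lo_ge0 ivl_max_lo_le_hi ivl_max_hi_le1.

Fact ivl_min_lo_ge0 : 0 <= Num.min (lo x) (lo y).
Proof. by rewrite le_min !lo_ge0. Qed.

Fact ivl_min_lo_le_hi : Num.min (lo x) (lo y) <= Num.min (hi x) (hi y).
Proof. by rewrite le_min !ge_min !lo_le_hi orbT. Qed.

Fact ivl_min_hi_le1 : Num.min (hi x) (hi y) <= 1.
Proof. by rewrite ge_min hi_le1. Qed.

Definition ivl_min : unit_ivl R :=
  UnitIvl ivl_min_lo_ge0 ivl_min_lo_le_hi ivl_min_hi_le1.

End IntervalMaxMin.

(* Interval-valued hesitant fuzzy elements; the set need not be finite. *)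
Record ivhfe (R : realType) := Ivhfe {
  ivhfe_set :> set (unit_ivl R);
  ivhfe_neq0 : ivhfe_set !=set0 }.

Lemma ivhfe_ext (R : realType) (mu nu : ivhfe R) :
  ivhfe_set mu = ivhfe_set nu -> mu = nu.
Proof.
case: mu nu => [m p] [n q] /= e; subst n.
by rewrite (Prop_irrelevance p q).
Qed.

Section IvhfeOperations.
Variables (R : realType) (mu nu : ivhfe R).

Fact ivhfe_union_neq0 : [set ivl_max x y | x in mu & y in nu] !=set0.
Proof.
have [x mx] := ivhfe_neq0 mu; have [y ny] := ivhfe_neq0 nu.
by exists (ivl_max x y), x => //; exists y.
Qed.

Definition ivhfe_union : ivhfe R := Ivhfe ivhfe_union_neq0.

Fact ivhfe_inter_neq0 : [set ivl_min x y | x in mu & y in nu] !=set0.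
Proof.
have [x mx] := ivhfe_neq0 mu; have [y ny] := ivhfe_neq0 nu.
by exists (ivl_min x y), x => //; exists y.
Qed.

Definition ivhfe_inter : ivhfe R := Ivhfe ivhfe_inter_neq0.

End IvhfeOperations.

(* Interval-valued hesitant fuzzy soft sets F_A over (U, E), bundled with
   their parameter set A; the values exist only for parameters in A. The
   parameter set may be empty, so nonemptiness is a separate hypothesis. *)
Record ivhfss (R : realType) (U E : Type) := Ivhfss {
  params : set E;
  value : forall e : E, params e -> U -> ivhfe R }.

(* Leibniz equality of soft sets is equality of the parameter sets together
   with equality of all the values. *)
Lemma ivhfss_eqP (R : realType) (U E : Type) (F G : ivhfss R U E) :
  F = G <->
  params F = params G /\
  forall (e : E) (eF : params F e) (eG : params G e) (h : U),
    value eF h = value eG h.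
Proof.
split=> [->|].
  by split=> // e eF eG h; rewrite (Prop_irrelevance eF eG).
case: F G => [A f] [B g] /= [eAB]; subst B => fg.
congr Ivhfss; apply: functional_extensionality_dep => e.
apply: functional_extensionality_dep => eA; apply: funext => h.
exact: fg.
Qed.

Section IvhfssOperations.
Variables (R : realType) (U E : Type) (F G : ivhfss R U E).

Definition ivhfss_union_value (e : E) (eFG : (params F `|` params G) e)
    (h : U) : ivhfe R :=
  match pselect (params F e), pselect (params G e) with
  | left eF, left eG => ivhfe_union (value eF h) (value eG h)
  | left eF, right _ => value eF h
  | right _, left eG => value eG h
  | right neF, right neG =>
      False_rect _ (match eFG with or_introl eF => neF eF
                                 | or_intror eG => neG eG end)
  end.

Definition ivhfss_union : ivhfss R U E := Ivhfss ivhfss_union_value.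

(* Total: when the parameter sets are disjoint, where the intersection is
   usually left undefined, this is the soft set with no parameter. *)
Definition ivhfss_inter : ivhfss R U E :=
  @Ivhfss R U E (params F `&` params G)
    (fun e eFG h => ivhfe_inter (value eFG.1 h) (value eFG.2 h)).

End IvhfssOperations.

(* Main.v *)
Require Import Defs.
From HB Require Import structures.
From mathcomp Require Import all_boot all_order all_algebra.
From mathcomp Require Import boolp classical_sets reals.

(** The endpointwise maximum and minimum of intervals are commutative and
    associative because [max] and [min] are. Both laws pass to the elementwise
    image of two sets of intervals ([image2C], [image2A]), hence to the union
    and intersection of hesitant fuzzy elements.

    For soft sets the parameter sets agree by the laws of set union and
    intersection, so by [ivhfss_eqP] only the values are left to compare. For
    intersections the value at a parameter is the intersection of the given
    values, and the element laws apply at once. For unions one splits on which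
    of the parameter sets contain the parameter: [ivhfss_union_valueI],
    [ivhfss_union_valueL] and [ivhfss_union_valueR] compute the value in the
    three cases, and the element laws are needed only where the parameter
    belongs to all the sets involved. *)

Import Order.TTheory.
Local Open Scope classical_set_scope.

Lemma image2C (T rT : Type) (f : T -> T -> rT) (A B : set T) :
  commutative f ->
  [set f x y | x in A & y in B] = [set f x y | x in B & y in A].
Proof.
move=> fC; apply/seteqP; split=> _ [x Ax [y By <-]];
  by exists y => //; exists x => //; rewrite fC.
Qed.

Lemma image2A (T : Type) (f : T -> T -> T) (A B C : set T) :
  associative f ->
  [set f x y | x in A & y in [set f x y | x in B & y in C]] =
  [set f x y | x in [set f x y | x in A & y in B] & y in C].
Proof.
move=> fA; apply/seteqP; split=> [_ [x Ax [_ [y By [z Cz <-]] <-]]|].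
  by exists (f x y); [exists x => //; exists y | exists z].
move=> _ [_ [x Ax [y By <-]] [z Cz <-]].
by exists x => //; exists (f y z); [exists y => //; exists z|].
Qed.

Lemma ivl_maxC (R : realType) : commutative (@ivl_max R).
Proof. by move=> x y; apply: unit_ivl_ext; rewrite /= maxC. Qed.

Lemma ivl_maxA (R : realType) : associative (@ivl_max R).
Proof. by move=> x y z; apply: unit_ivl_ext; rewrite /= maxA. Qed.

Lemma ivl_minC (R : realType) : commutative (@ivl_min R).
Proof. by move=> x y; apply: unit_ivl_ext; rewrite /= minC. Qed.

Lemma ivl_minA (R : realType) : associative (@ivl_min R).
Proof. by move=> x y z; apply: unit_ivl_ext; rewrite /= minA. Qed.

Lemma ivhfe_unionC (R : realType) : commutative (@ivhfe_union R).
Proof. by move=> mu nu; apply/ivhfe_ext/image2C/ivl_maxC. Qed.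

Lemma ivhfe_unionA (R : realType) : associative (@ivhfe_union R).
Proof. by move=> mu nu xi; apply/ivhfe_ext/image2A/ivl_maxA. Qed.

Lemma ivhfe_interC (R : realType) : commutative (@ivhfe_inter R).
Proof. by move=> mu nu; apply/ivhfe_ext/image2C/ivl_minC. Qed.

Lemma ivhfe_interA (R : realType) : associative (@ivhfe_inter R).
Proof. by move=> mu nu xi; apply/ivhfe_ext/image2A/ivl_minA. Qed.

Section SoftSets.
Variables (R : realType) (U E : Type).
Implicit Types (F G H : ivhfss R U E) (e : E) (h : U).

Lemma value_irrelevance F e (p q : params F e) h : value p h = value q h.
Proof. by rewrite (Prop_irrelevance p q). Qed.

(** The values of a union are described for arbitrary membership proofs,
    since in an iterated union these proofs come in different forms. *)
Lemma ivhfss_union_valueI F G e (eF : params F e) (eG : params G e)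
    (eFG : params (ivhfss_union F G) e) h :
  value eFG h = ivhfe_union (value eF h) (value eG h).
Proof.
rewrite /= /ivhfss_union_value.
case: pselect => // eF'; case: pselect => // eG'.
by congr ivhfe_union; exact: value_irrelevance.
Qed.

Lemma ivhfss_union_valueL F G e (eF : params F e) (neG : ~ params G e)
    (eFG : params (ivhfss_union F G) e) h :
  value eFG h = value eF h.
Proof.
rewrite /= /ivhfss_union_value.
case: pselect => // eF'; case: pselect => // neG'.
exact: value_irrelevance.
Qed.

Lemma ivhfss_union_valueR F G e (neF : ~ params F e) (eG : params G e)
    (eFG : params (ivhfss_union F G) e) h :
  value eFG h = value eG h.
Proof.
rewrite /= /ivhfss_union_value.
case: pselect => // neF'; case: pselect => // eG'.
exact: value_irrelevance.
Qed.

Arguments ivhfss_union_valueI {F G e} eF eG eFG h.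
Arguments ivhfss_union_valueL {F G e} eF neG eFG h.
Arguments ivhfss_union_valueR {F G e} neF eG eFG h.

Lemma ivhfss_unionC F G : ivhfss_union F G = ivhfss_union G F.
Proof.
apply/ivhfss_eqP; split=> [|e eFG eGF h]; first exact: setUC.
have [eF|neF] := pselect (params F e); have [eG|neG] := pselect (params G e).
- rewrite (ivhfss_union_valueI eF eG) (ivhfss_union_valueI eG eF).
  exact: ivhfe_unionC.
- by rewrite (ivhfss_union_valueL eF neG) (ivhfss_union_valueR neG eF).
- by rewrite (ivhfss_union_valueR neF eG) (ivhfss_union_valueL eG neF).
- by case: eFG.
Qed.

Lemma ivhfss_unionA F G H :
  ivhfss_union F (ivhfss_union G H) = ivhfss_union (ivhfss_union F G) H.
Proof.
apply/ivhfss_eqP; split=> [|e eFGH eFGH' h]; first exact: setUA.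
have [eF|neF] := pselect (params F e); have [eG|neG] := pselect (params G e);
  have [eH|neH] := pselect (params H e).
- pose eGH : params (ivhfss_union G H) e := or_introl eG.
  pose eFG : params (ivhfss_union F G) e := or_introl eF.
  rewrite (ivhfss_union_valueI eF eGH) (ivhfss_union_valueI eG eH).
  rewrite (ivhfss_union_valueI eFG eH) (ivhfss_union_valueI eF eG).
  exact: ivhfe_unionA.
- pose eGH : params (ivhfss_union G H) e := or_introl eG.
  pose eFG : params (ivhfss_union F G) e := or_introl eF.
  rewrite (ivhfss_union_valueI eF eGH) (ivhfss_union_valueL eG neH).
  by rewrite (ivhfss_union_valueL eFG neH) (ivhfss_union_valueI eF eG).
- pose eGH : params (ivhfss_union G H) e := or_intror eH.
  pose eFG : params (ivhfss_union F G) e := or_introl eF.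
  rewrite (ivhfss_union_valueI eF eGH) (ivhfss_union_valueR neG eH).
  by rewrite (ivhfss_union_valueI eFG eH) (ivhfss_union_valueL eF neG).
- have neGH : ~ params (ivhfss_union G H) e by case.
  pose eFG : params (ivhfss_union F G) e := or_introl eF.
  rewrite (ivhfss_union_valueL eF neGH).
  by rewrite (ivhfss_union_valueL eFG neH) (ivhfss_union_valueL eF neG).
- pose eGH : params (ivhfss_union G H) e := or_introl eG.
  pose eFG : params (ivhfss_union F G) e := or_intror eG.
  rewrite (ivhfss_union_valueR neF eGH) (ivhfss_union_valueI eG eH).
  by rewrite (ivhfss_union_valueI eFG eH) (ivhfss_union_valueR neF eG).
- pose eGH : params (ivhfss_union G H) e := or_introl eG.
  pose eFG : params (ivhfss_union F G) e := or_intror eG.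
  rewrite (ivhfss_union_valueR neF eGH) (ivhfss_union_valueL eG neH).
  by rewrite (ivhfss_union_valueL eFG neH) (ivhfss_union_valueR neF eG).
- pose eGH : params (ivhfss_union G H) e := or_intror eH.
  have neFG : ~ params (ivhfss_union F G) e by case.
  rewrite (ivhfss_union_valueR neF eGH) (ivhfss_union_valueR neG eH).
  by rewrite (ivhfss_union_valueR neFG eH).
- by case: eFGH => [|[]].
Qed.

Lemma ivhfss_interC F G : ivhfss_inter F G = ivhfss_inter G F.
Proof.
apply/ivhfss_eqP; split=> [|e eFG eGF h] /=; first exact: setIC.
rewrite ivhfe_interC.
by congr ivhfe_inter; exact: value_irrelevance.
Qed.

Lemma ivhfss_interA F G H :
  ivhfss_inter F (ivhfss_inter G H) = ivhfss_inter (ivhfss_inter F G) H.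
Proof.
apply/ivhfss_eqP; split=> [|e eFGH eFGH' h] /=; first exact: setIA.
rewrite ivhfe_interA.
by congr ivhfe_inter; [congr ivhfe_inter|]; exact: value_irrelevance.
Qed.

End SoftSets.

Theorem proposition3p8 (R : realType) (U E : Type) (F G H : ivhfss R U E)
    (hA : params F !=set0) (hB : params G !=set0) (hC : params H !=set0) :
  [/\ ivhfss_union F G = ivhfss_union G F,
      params F `&` params G !=set0 ->
        ivhfss_inter F G = ivhfss_inter G F,
      ivhfss_union F (ivhfss_union G H) = ivhfss_union (ivhfss_union F G) H
    & params F `&` params G `&` params H !=set0 ->
        ivhfss_inter F (ivhfss_inter G H) = ivhfss_inter (ivhfss_inter F G) H].
Proof.
split=> [|_||_]; [exact: ivhfss_unionC | exact: ivhfss_interC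
                 |exact: ivhfss_unionA | exact: ivhfss_interA].
Qed.
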